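(* Let $k\ge1$ be an integer, let $g(n)$ be the number of row-convex $k$-omino towers made of $n$ blocks, and $f_\ell(n)$ the number of row-convex $k$-omino towers made of $n$ blocks resting on a platform of width $\ell k$. Let $G(z)=\sum_{n\ge0} g(n)z^n$ and $F_\ell(z)=\sum_{n\ge0} f_\ell(n)z^n$. Then $$G(z)=\sum_{\ell=1}^\infty z^\ell F_{\ell}(z),$$ where $$F_\ell(z) = \frac{(1+kz)T_{1,\ell}+(kz^2-1)T_{2,\ell}+(k-1)z^3T_{3,\ell}}{(1-(2k-1)(1+z)z+k^2 z^3)T_{1,2}+(k-1) ((2k-1)z-1) z^3 T_{1,3}+(k-1)^2 z^5T_{2,3}},$$ with $T_{s,t}(z)=A_s B_t - A_t B_s$, $$A_\ell(z)=\sum_{j=0}^\infty \frac{z^{\ell j} h_j }{(z;z)_j^2},\qquad B_\ell(z)=\sum _{j=0}^{\infty} \frac{z^{\ell j} h_j }{(z;z)_j^2} \Bigg (\ell+\sum _{m=1}^j \Big (1+\frac{2}{1-z^m}-\frac{1}{1+(k-1) z^m} \Big) \Bigg ),$$ and $h_j(z)=z^{j(j+1)}\left((1-k)z;z\right)_j$.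
   Context: A $k$-omino is a block of height $1$ and width $k$ placed on the integer lattice, occupying unit columns $a,\ldots,a+k-1$ of some row. A $k$-omino tower is a finite nonempty set of non-overlapping $k$-ominos in rows $0,1,\ldots$ such that the blocks in row $0$ form a contiguous interval and each block in row $r\ge1$ shares at least one unit column with a block in row $r-1$; towers are counted up to horizontal translation. A tower resting on a platform of width $\ell k$ is a (possibly empty) finite set of non-overlapping $k$-ominos in rows $1,2,\ldots$ above a platform occupying columns $0,\ldots,\ell k-1$ of row $0$, such that each block in row $1$ shares at least one unit column with the platform and each block in row $r\ge2$ shares at least one unit column with a block in row $r-1$ (so $f_\ell(0)=1$). A tower is row-convex if the union of its blocks in each row is a contiguous interval. The $q$-Pochhammer symbol is $(a;q)_n=\prod_{i=0}^{n-1}(1-aq^i)$. All series are formal power series in $z$. *)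

(* Defs.v *)
From HB Require Import structures.
From mathcomp Require Import all_boot all_order all_algebra finmap.
From mathcomp Require Import boolp classical_sets cardinality.

Set Implicit Arguments.
Unset Strict Implicit.
Unset Printing Implicit Defensive.

Import Order.TTheory GRing.Theory Num.Theory.

Local Open Scope ring_scope.
Local Open Scope classical_set_scope.

(* A record rather than [nat -> R] itself, so that the Cauchy product does not
   compete with the pointwise product of functions. *)
Record fps (R : Type) : Type := Fps { fps_coef : nat -> R }.

Section FpsRing.
Variable R : comUnitRingType.
Implicit Types f g h : fps R.

HB.instance Definition _ := gen_eqMixin (fps R).
HB.instance Definition _ := gen_choiceMixin (fps R).

Lemma fpsP f g : fps_coef f =1 fps_coef g -> f = g.
Proof. by case: f g => [f] [g] /= /funext ->. Qed.

Definition fps_zero : fps R := Fps (fun=> 0).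
Definition fps_opp f : fps R := Fps (fun n => - fps_coef f n).
Definition fps_add f g : fps R := Fps (fun n => fps_coef f n + fps_coef g n).

Fact fps_addA : associative fps_add.
Proof. by move=> f g h; apply: fpsP => n /=; rewrite addrA. Qed.
Fact fps_addC : commutative fps_add.
Proof. by move=> f g; apply: fpsP => n /=; rewrite addrC. Qed.
Fact fps_add0 : left_id fps_zero fps_add.
Proof. by move=> f; apply: fpsP => n /=; rewrite add0r. Qed.
Fact fps_addN : left_inverse fps_zero fps_opp fps_add.
Proof. by move=> f; apply: fpsP => n /=; rewrite addNr. Qed.

HB.instance Definition _ := GRing.isZmodule.Build (fps R)
  fps_addA fps_addC fps_add0 fps_addN.

Definition fps_one : fps R := Fps (fun n => (n == 0%N)%:R).
Definition fps_mul f g : fps R :=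
  Fps (fun n => \sum_(i < n.+1) fps_coef f i * fps_coef g (n - i)).

Definition fps_trunc N f : {poly R} := \poly_(i < N.+1) fps_coef f i.

Fact coef_fps_trunc N f n : (n <= N)%N -> (fps_trunc N f)`_n = fps_coef f n.
Proof. by move=> le_nN; rewrite coef_poly ltnS le_nN. Qed.

Fact coef_fps_mul N f g n : (n <= N)%N ->
  fps_coef (fps_mul f g) n = (fps_trunc N f * fps_trunc N g)`_n.
Proof.
move=> le_nN; rewrite coefM; apply: eq_bigr => i _.
rewrite !coef_fps_trunc //; first by apply: leq_trans le_nN; apply: leq_subr.
by apply: leq_trans le_nN; rewrite -ltnS.
Qed.

Fact fps_mulA : associative fps_mul.
Proof.
move=> f g h; apply: fpsP => n.
transitivity ((fps_trunc n f * (fps_trunc n g * fps_trunc n h))`_n).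
  rewrite coefM; apply: eq_bigr => i _.
  have le_in : (i <= n)%N by rewrite -ltnS.
  by rewrite coef_fps_trunc // (@coef_fps_mul n) ?leq_subr.
rewrite mulrA coefM; apply: eq_bigr => i _.
have le_in : (i <= n)%N by rewrite -ltnS.
by rewrite coef_fps_trunc ?leq_subr // (@coef_fps_mul n).
Qed.
Fact fps_mulC : commutative fps_mul.
Proof. by move=> f g; apply: fpsP => n; rewrite !(@coef_fps_mul n) // mulrC. Qed.
Fact fps_mul1 : left_id fps_one fps_mul.
Proof.
move=> f; apply: fpsP => n /=.
rewrite big_ord_recl /= mul1r subn0 big1 ?addr0 // => i _.
by rewrite mul0r.
Qed.
Fact fps_mulDl : left_distributive fps_mul fps_add.
Proof.
move=> f g h; apply: fpsP => n /=.
by rewrite -big_split; apply: eq_bigr => i _; rewrite mulrDl.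
Qed.
Fact fps_one_neq0 : fps_one != 0.
Proof.
by apply/eqP => /(congr1 (fun f => fps_coef f 0)) /eqP; rewrite /= oner_eq0.
Qed.

HB.instance Definition _ := GRing.Zmodule_isComNzRing.Build (fps R)
  fps_mulA fps_mulC fps_mul1 fps_mulDl fps_one_neq0.

Lemma fps_coef0 n : fps_coef (0 : fps R) n = 0.
Proof. by []. Qed.
Lemma fps_coef1 n : fps_coef (1 : fps R) n = (n == 0%N)%:R.
Proof. by []. Qed.
Lemma fps_coefN f n : fps_coef (- f) n = - fps_coef f n.
Proof. by []. Qed.
Lemma fps_coefD f g n : fps_coef (f + g) n = fps_coef f n + fps_coef g n.
Proof. by []. Qed.
Lemma fps_coefM f g n :
  fps_coef (f * g) n = \sum_(i < n.+1) fps_coef f i * fps_coef g (n - i).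
Proof. by []. Qed.
Lemma fps_coef_sum (I : Type) (r : seq I) (P : pred I) (F : I -> fps R) n :
  fps_coef (\sum_(i <- r | P i) F i) n = \sum_(i <- r | P i) fps_coef (F i) n.
Proof. by elim/big_rec2: _ => // i x y _ <-. Qed.

Definition fpsC (c : R) : fps R := Fps (fun n => if n == 0%N then c else 0).
Definition fpsX : fps R := Fps (fun n => (n == 1%N)%:R).

Lemma fps_coefCM c f n : fps_coef (fpsC c * f) n = c * fps_coef f n.
Proof.
rewrite fps_coefM big_ord_recl /= subn0 big1 ?addr0 // => i _.
by rewrite mul0r.
Qed.

Lemma fps_coefM0 f g : fps_coef (f * g) 0 = fps_coef f 0 * fps_coef g 0.
Proof. by rewrite fps_coefM big_ord1. Qed.

Definition fps_val_ge m f := forall n, (n < m)%N -> fps_coef f n = 0.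

Lemma fps_val_geM m p f g :
  fps_val_ge m f -> fps_val_ge p g -> fps_val_ge (m + p) (f * g).
Proof.
move=> vf vg n lt_n; rewrite fps_coefM big1 // => i _.
have [lt_im | le_mi] := ltnP i m; first by rewrite vf ?mul0r.
rewrite (vg (n - i)%N) ?mulr0 // ltn_subLR -1?ltnS //.
by apply: leq_trans lt_n _; rewrite leq_add2r.
Qed.

Lemma fps_val_geX m f : fps_val_ge 1 f -> fps_val_ge m (f ^+ m).
Proof.
move=> vf; elim: m => [|m IHm] //.
by rewrite exprS -add1n; apply: fps_val_geM.
Qed.

Lemma fps_val_geW m p f : (p <= m)%N -> fps_val_ge m f -> fps_val_ge p f.
Proof. by move=> le_pm vf n lt_np; apply: vf; apply: leq_trans le_pm. Qed.

Lemma fps_val_geMl m f g : fps_val_ge m f -> fps_val_ge m (f * g).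
Proof. by move=> vf; rewrite -[m]addn0; apply: fps_val_geM. Qed.

Lemma fps_val_ge_fpsXn m : fps_val_ge m (fpsX ^+ m).
Proof. by apply: fps_val_geX => -[|n]. Qed.

Lemma fps_coef_sum_val_ge (u : nat -> fps R) i N :
  (forall j, fps_val_ge j (u j)) -> (i < N)%N ->
  fps_coef (\sum_(j < N) u j) i = fps_coef (\sum_(j < i.+1) u j) i.
Proof.
move=> vu; elim: N => // N IHN; rewrite ltnS leq_eqVlt => /predU1P[-> // | lt_iN].
by rewrite big_ord_recr fps_coefD vu // addr0 IHN.
Qed.

(* The units are the series with invertible constant term; their inverse is
   the geometric series of 1 - f / f(0). *)
Definition fps_unit : {pred fps R} :=
  [pred f | fps_coef f 0 \is a GRing.unit].
Definition fps_geom (c : fps R) : fps R :=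
  Fps (fun n => fps_coef (\sum_(j < n.+1) c ^+ j) n).
Definition fps_inv f : fps R :=
  if f \in fps_unit then
    let c := fpsC (fps_coef f 0)^-1 in fps_geom (1 - c * f) * c
  else f.

Fact fps_geomP c : fps_coef c 0 = 0 -> fps_geom c * (1 - c) = 1.
Proof.
move=> c0.
have vc : fps_val_ge 1 c by case=> [|n] //; rewrite c0.
apply: fpsP => n.
transitivity (fps_coef ((\sum_(j < n.+1) c ^+ j) * (1 - c)) n).
  rewrite !fps_coefM; apply: eq_bigr => i _; congr (_ * _).
  by rewrite (fps_coef_sum_val_ge (fun j => fps_val_geX vc) (ltn_ord i)).
have -> : (\sum_(j < n.+1) c ^+ j) * (1 - c) = 1 - c ^+ n.+1.
  by rewrite -[RHS]opprB subrX1 mulrC -mulNr opprB.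
by rewrite fps_coefD fps_coefN (fps_val_geX vc) ?subr0.
Qed.

Fact fps_mulVr : {in fps_unit, left_inverse 1 fps_inv *%R}.
Proof.
move=> f uf; rewrite /fps_inv uf /= -mulrA.
set c := fpsC _; rewrite -[X in _ * X](subKr 1); apply: fps_geomP.
by rewrite fps_coefD fps_coefN fps_coefCM mulVr ?subrr.
Qed.
Fact fps_unitP f g : g * f = 1 -> fps_unit f.
Proof.
move=> /(congr1 (fun h => fps_coef h 0)); rewrite fps_coefM0 => gf1.
by rewrite /fps_unit /=; apply/unitrPr; exists (fps_coef g 0); rewrite mulrC.
Qed.
Fact fps_inv_out : {in [predC fps_unit], fps_inv =1 id}.
Proof. by move=> f; rewrite inE /= /fps_inv => /negbTE ->. Qed.

HB.instance Definition _ := GRing.ComNzRing_hasMulInverse.Build (fps R)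
  fps_mulVr fps_unitP fps_inv_out.

(* Convergence in the z-adic topology: each coefficient of the partial sums is
   eventually constant. *)
Definition fps_has_sum (u : nat -> fps R) (s : fps R) : Prop :=
  forall n, exists N, forall M, (N <= M)%N ->
    fps_coef (\sum_(j < M) u j) n = fps_coef s n.

(* The sum of a convergent series, and 0 for a divergent one. *)
Definition fps_sum (u : nat -> fps R) : fps R := xget 0 [set s | fps_has_sum u s].

Lemma fps_has_sum_unique u s t : fps_has_sum u s -> fps_has_sum u t -> s = t.
Proof.
move=> us ut; apply: fpsP => n; have [N sN] := us n; have [P tP] := ut n.
by rewrite -(sN (maxn N P)) ?leq_maxl // tP ?leq_maxr.
Qed.

Lemma fps_sumP u s : fps_has_sum u s -> fps_has_sum u (fps_sum u).
Proof. by move=> us; exact: (@xgetI _ 0 (fps_has_sum u) s us). Qed.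

Lemma fps_sumE u s : fps_has_sum u s -> fps_sum u = s.
Proof. by move=> us; apply: (fps_has_sum_unique _ us); apply: (fps_sumP us). Qed.

Lemma fps_sum_val_ge u :
  (forall j, fps_val_ge j (u j)) -> fps_has_sum u (fps_sum u).
Proof.
move=> vu; apply: (@fps_sumP u (Fps (fun n => fps_coef (\sum_(j < n.+1) u j) n))).
by move=> n; exists n.+1 => M /(fps_coef_sum_val_ge vu) ->.
Qed.

End FpsRing.

Arguments fpsX {R}.

(* The block (r, a) lies in row r and occupies the columns a, ..., a + k - 1. *)
Definition block : Type := (nat * int)%type.

Definition block_cols (k : nat) (b : block) : set int :=
  [set x | b.2 <= x < b.2 + k%:Z].

Definition row_cols (k : nat) (T : {fset block}) (r : nat) : set int :=
  [set x | exists2 b, b \in T & b.1 = r /\ block_cols k b x].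

Definition contiguous (S : set int) : Prop :=
  exists a b : int, S = [set x | a <= x < b].

Definition non_overlapping (k : nat) (T : {fset block}) : Prop :=
  forall b b', b \in T -> b' \in T -> b.1 = b'.1 -> b != b' ->
    block_cols k b `&` block_cols k b' = set0.

Definition share_column (S S' : set int) : Prop := S `&` S' !=set0.

Definition row_convex (k : nat) (T : {fset block}) : Prop :=
  forall r, contiguous (row_cols k T r).

Definition is_tower (k : nat) (T : {fset block}) : Prop :=
  [/\ T != fset0,
      non_overlapping k T,
      contiguous (row_cols k T 0)
    & forall b, b \in T -> (1 <= b.1)%N ->
        exists2 b', b' \in T &
          b'.1.+1 = b.1 /\ share_column (block_cols k b) (block_cols k b')].

Definition platform_cols (k l : nat) : set int := [set x | 0 <= x < (l * k)%N%:Z].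

Definition is_platform_tower (k l : nat) (T : {fset block}) : Prop :=
  [/\ forall b, b \in T -> (1 <= b.1)%N,
      non_overlapping k T,
      forall b, b \in T -> b.1 = 1%N ->
        share_column (block_cols k b) (platform_cols k l)
    & forall b, b \in T -> (2 <= b.1)%N ->
        exists2 b', b' \in T &
          b'.1.+1 = b.1 /\ share_column (block_cols k b) (block_cols k b')].

Definition translate (c : int) (T : {fset block}) : {fset block} :=
  [fset ((b.1, b.2 + c)%R : block) | b in T]%fset.

Definition translates (T : {fset block}) : set {fset block} :=
  [set translate c T | c in [set: int]].

(* [fset_set] sends an infinite set to the empty one; only finite sets of
   towers are counted below. *)
Definition num (U : choiceType) (S : set U) : nat := #|` fset_set S|%fset.

(* Towers up to horizontal translation are counted as translation classes. *)
Definition g (k n : nat) : nat :=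
  num [set translates T | T in
        [set T | [/\ is_tower k T, row_convex k T & #|` T|%fset = n]]].

Definition f (k l n : nat) : nat :=
  num [set T | [/\ is_platform_tower k l T, row_convex k T & #|` T|%fset = n]].

Definition z : fps rat := fpsX.

Definition G (k : nat) : fps rat := Fps (fun n => (g k n)%:R).
Definition F (k l : nat) : fps rat := Fps (fun n => (f k l n)%:R).

Definition qpoch (a q : fps rat) (n : nat) : fps rat :=
  \prod_(i < n) (1 - a * q ^+ i).

Definition h (k j : nat) : fps rat :=
  z ^+ (j * (j + 1)) * qpoch ((1 - k%:R) * z) z j.

Definition A_term (k l j : nat) : fps rat :=
  z ^+ (l * j) * h k j / qpoch z z j ^+ 2.

Definition B_term (k l j : nat) : fps rat :=
  z ^+ (l * j) * h k j / qpoch z z j ^+ 2 *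
  (l%:R + \sum_(1 <= m < j.+1)
            (1 + 2 / (1 - z ^+ m) - 1 / (1 + (k%:R - 1) * z ^+ m))).

Definition A (k l : nat) : fps rat := fps_sum (A_term k l).
Definition B (k l : nat) : fps rat := fps_sum (B_term k l).

Definition T (k s t : nat) : fps rat := A k s * B k t - A k t * B k s.

Lemma A_has_sum k l : fps_has_sum (A_term k l) (A k l).
Proof.
apply: fps_sum_val_ge => j; rewrite /A_term /h mulrCA -!mulrA.
apply: fps_val_geMl; apply: fps_val_geW (@fps_val_ge_fpsXn _ _).
by case: j => // j; rewrite addn1 leq_pmulr.
Qed.

Lemma B_has_sum k l : fps_has_sum (B_term k l) (B k l).
Proof.
apply: fps_sum_val_ge => j; rewrite /B_term /h mulrCA -!mulrA.
apply: fps_val_geMl; apply: fps_val_geW (@fps_val_ge_fpsXn _ _).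
by case: j => // j; rewrite addn1 leq_pmulr.
Qed.

(* Main.v *)
(* Removing the bottom row shows that F_l is determined, coefficient by
   coefficient, by F_l = 1 + \sum_(1 <= m <= l + 1) ((l + 2 - m) k - 1) z^m F_m:
   a row of m blocks can be placed in (l + 2 - m) k - 1 ways on a platform of
   width l k, and then serves as the platform of the rest.  Taking second
   differences in l gives the linear recurrence
     X_(l+2) - 2 X_(l+1) + X_l = z^(l+2) X_(l+2) + (k - 1) z^(l+3) X_(l+3),
   which A and B satisfy (the summand of A is a Frobenius solution in z^l, and B
   is its derivative with respect to the exponent).  The combination of A and B
   with the right values of X_1 and X_2 - X_1 is the claimed quotient, so it
   solves the first system and equals F_l. *)
Require Import Defs.
From mathcomp Require Import all_boot all_order all_algebra finmap.
From mathcomp Require Import boolp classical_sets cardinality.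
From mathcomp Require Import zify ring.

Set Implicit Arguments.
Unset Strict Implicit.
Unset Printing Implicit Defensive.

Import Order.TTheory GRing.Theory Num.Theory.

Local Open Scope ring_scope.
Local Open Scope classical_set_scope.

(** * Convergent series of power series *)

Section FpsSums.
Variable R : comUnitRingType.
Implicit Types (u v : nat -> fps R) (s t c : fps R).

Lemma fps_has_sumD u v s t : fps_has_sum u s -> fps_has_sum v t ->
  fps_has_sum (fun j => u j + v j) (s + t).
Proof.
move=> us vt n; have [N uN] := us n; have [P vP] := vt n.
exists (maxn N P) => M; rewrite geq_max => /andP[NM PM].
by rewrite big_split !fps_coefD uN ?vP.
Qed.

Lemma fps_has_sumM c u s : fps_has_sum u s ->
  fps_has_sum (fun j => c * u j) (c * s).
Proof.
move=> us n.
(* The [n]-th coefficient of a product involves every coefficient of [s] of index at most [n], so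
   one threshold must serve all of them. *)
have [N uN] : exists N, forall M i, (N <= M)%N -> (i <= n)%N ->
    fps_coef (\sum_(j < M) u j) i = fps_coef s i.
  elim: n => [|n [N uN]].
    by have [N uN] := us 0%N; exists N => M i /uN + /[!leqn0] /eqP ->.
  have [P uP] := us n.+1; exists (maxn N P) => M i; rewrite geq_max => /andP[NM PM].
  by rewrite leq_eqVlt => /predU1P[->|]; [apply: uP | apply: uN].
exists N => M NM; rewrite -mulr_sumr !fps_coefM.
by apply: eq_bigr => i _; rewrite uN ?leq_subr.
Qed.

Lemma fps_has_sum_shift u s : u 0%N = 0 -> fps_has_sum u s ->
  fps_has_sum (fun j => u j.+1) s.
Proof.
move=> u0 us n; have [N uN] := us n; exists N => M NM.
by rewrite -(uN M.+1) ?leqW // [in RHS]big_ord_recl u0 add0r.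
Qed.

Lemma fps_unit1DM m c : (0 < m)%N -> 1 + c * fpsX ^+ m \is a GRing.unit.
Proof.
move=> m0; suff: fps_coef (1 + c * fpsX ^+ m) 0 \is a GRing.unit by [].
by rewrite fps_coefD fps_coefM0 (@fps_val_ge_fpsXn _ m) // mulr0 addr0 unitr1.
Qed.

Lemma fps_unit1B m : (0 < m)%N -> (1 - fpsX ^+ m : fps R) \is a GRing.unit.
Proof. by move=> m0; rewrite -[X in 1 - X]mul1r -mulNr fps_unit1DM. Qed.

Lemma fps_coefXnM m s n :
  fps_coef (fpsX ^+ m * s) n = if (m <= n)%N then fps_coef s (n - m) else 0.
Proof.
elim: m n => [|m IH] n; first by rewrite expr0 mul1r subn0.
rewrite exprS -mulrA; move: (fpsX ^+ m * s) IH => t IH; rewrite fps_coefM.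
case: n => [|n]; first by rewrite big_ord1 /= mul0r.
rewrite big_ord_recl /= mul0r add0r big_ord_recl /= mul1r big1 ?addr0.
  by rewrite /bump /= addn0 subSS subn0 IH.
by move=> i _; rewrite /= mul0r.
Qed.

Lemma fps_coef_natM a s n : fps_coef (a%:R * s) n = a%:R * fps_coef s n.
Proof.
rewrite !mulr_natl; elim: a => [|a IH]; first by rewrite !mulr0n.
by rewrite !mulrS fps_coefD IH.
Qed.

Lemma fps_has_sum_coef0 u s : fps_has_sum u s ->
  (forall j, fps_coef (u j.+1) 0 = 0) -> fps_coef s 0 = fps_coef (u 0%N) 0.
Proof.
move=> us u0; have [N uN] := us 0%N.
by rewrite -(uN N.+1) // big_ord_recl fps_coefD fps_coef_sum big1 ?addr0 // => i _; exact: u0.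
Qed.

End FpsSums.

(** * The recurrence satisfied by A and B *)

(* The number of ways to put a row of [m] blocks on a platform of width [l * k];
   it is 0 for [m > l + 1], by truncated subtraction. *)
Definition stack_num (k l m : nat) : nat := ((l.+2 - m) * k).-1.

Section Recurrence.
Variable k : nat.

Definition hyp_coef (j : nat) : fps rat := h k j / qpoch z z j ^+ 2.

(** The ratio of consecutive [hyp_coef] is w^2 (1 + (k-1) w) / (1 - w)^2 at w = z^m. The summand
    here is the logarithmic derivative w d/dw of that ratio, so this is the logarithmic derivative
    of [hyp_coef j] with respect to a shift of the exponent. *)
Definition log_coef (j : nat) : fps rat :=
  \sum_(1 <= m < j.+1) (1 + 2 / (1 - z ^+ m) - 1 / (1 + (k%:R - 1) * z ^+ m)).

Lemma A_termE l j : A_term k l j = z ^+ (l * j) * hyp_coef j.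
Proof. by rewrite /A_term /hyp_coef mulrA. Qed.

Lemma B_termE l j :
  B_term k l j = z ^+ (l * j) * hyp_coef j * (l%:R + log_coef j).
Proof. by rewrite /B_term /hyp_coef mulrA. Qed.

Lemma qpochS (a q : fps rat) n : qpoch a q n.+1 = qpoch a q n * (1 - a * q ^+ n).
Proof. by rewrite /qpoch big_ord_recr. Qed.

Lemma hyp_coefS j : hyp_coef j.+1 =
  hyp_coef j * z ^+ j.+1 ^+ 2 * (1 + (k%:R - 1) * z ^+ j.+1) / (1 - z ^+ j.+1) ^+ 2.
Proof.
have uq n : qpoch z z n \is a GRing.unit.
  elim: n => [|n IH]; first by rewrite /qpoch big_ord0 unitr1.
  by rewrite qpochS unitrM IH -exprS fps_unit1B.
have u1 : 1 - z ^+ j.+1 \is a GRing.unit by apply: fps_unit1B.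
have Ek : (1 - k%:R) * z * z ^+ j = (1 - k%:R) * z ^+ j.+1 by rewrite exprS mulrA.
rewrite /hyp_coef /h !qpochS Ek -!exprS exprMn invrM ?unitrX //.
rewrite (_ : (j.+1 * (j.+1 + 1) = j * (j + 1) + (j.+1 + j.+1))%N); last by lia.
rewrite !exprD; move: ((qpoch z z j ^+ 2)^-1) (((1 - z ^+ j.+1) ^+ 2)^-1) (z ^+ j.+1).
by move=> p q w; ring.
Qed.

Definition tower_rec (X : nat -> fps rat) := forall l,
  X l.+2 - 2 * X l.+1 + X l = z ^+ l.+2 * X l.+2 + (k%:R - 1) * z ^+ l.+3 * X l.+3.

(** The recurrence is checked term by term: the extra factors z^(l+2) and z^(l+3) on the right turn
    a term of index j into one of index j+1, so the left side is reindexed once its term of index 0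
    is seen to vanish. *)
Lemma tower_rec_sum (u : nat -> nat -> fps rat) (X : nat -> fps rat) :
  (forall l, fps_has_sum (u l) (X l)) ->
  (forall l, u l.+2 0%N - 2 * u l.+1 0%N + u l 0%N = 0) ->
  (forall l j, u l.+2 j.+1 - 2 * u l.+1 j.+1 + u l j.+1 =
     z ^+ l.+2 * u l.+2 j + (k%:R - 1) * z ^+ l.+3 * u l.+3 j) ->
  tower_rec X.
Proof.
move=> uX u0 uS l.
have sl : fps_has_sum (fun j => u l.+2 j + - 2 * u l.+1 j + u l j)
                      (X l.+2 - 2 * X l.+1 + X l).
  by rewrite -mulNr; do 2?apply: fps_has_sumD => //; apply: fps_has_sumM.
apply: (fps_has_sum_unique (fps_has_sum_shift _ sl)); first by rewrite mulNr u0.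
rewrite (_ : (fun j => _) = fun j =>
    z ^+ l.+2 * u l.+2 j + (k%:R - 1) * z ^+ l.+3 * u l.+3 j).
  by apply: fps_has_sumD; apply: fps_has_sumM.
by apply: funext => j; rewrite mulNr uS.
Qed.

(** With w = z^(j+1), the second difference of w^l is w^l (1-w)^2, and the right side has the factor
    w^(l+2) (1 + (k-1) w). The claim is thus the ratio formula [hyp_coefS] with its denominator
    cleared. *)
Lemma A_rec : tower_rec (A k).
Proof.
apply: tower_rec_sum (A_has_sum k) _ _ => [l|l j]; rewrite !A_termE.
  by rewrite !muln0; ring.
have u1 : 1 - z ^+ j.+1 \is a GRing.unit by apply: fps_unit1B.
have H : hyp_coef j.+1 * (1 - z ^+ j.+1) ^+ 2 =
    hyp_coef j * z ^+ j.+1 ^+ 2 * (1 + (k%:R - 1) * z ^+ j.+1).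
  by rewrite hyp_coefS mulrVK ?unitrX.
rewrite ![(_ * j.+1)%N]mulnS ![(_ .+3 * j)%N]mulSn ![(_ .+2 * j)%N]mulSn.
rewrite ![(_ .+1 * j)%N]mulSn.
transitivity (z ^+ l * z ^+ (l * j) * (hyp_coef j.+1 * (1 - z ^+ j.+1) ^+ 2)).
  by rewrite !exprD !exprS; ring.
by rewrite H !exprD !exprS; ring.
Qed.

Lemma log_coefS j : log_coef j.+1 =
  log_coef j + (1 + 2 / (1 - z ^+ j.+1) - 1 / (1 + (k%:R - 1) * z ^+ j.+1)).
Proof. by rewrite /log_coef big_nat_recr. Qed.

Lemma B_rec : tower_rec (B k).
Proof.
apply: tower_rec_sum (B_has_sum k) _ _ => [l|l j]; rewrite !B_termE.
  by rewrite !muln0 -[l.+2]addn2 -[l.+1]addn1 !natrD; ring.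
have u1 : 1 - z ^+ j.+1 \is a GRing.unit by apply: fps_unit1B.
have u2 : 1 + (k%:R - 1) * z ^+ j.+1 \is a GRing.unit by apply: fps_unit1DM.
(* This is the identity used for [A], differentiated in the exponent. The terms 2 w^2 - 2 w, and on
   the right 2 + 3 (k-1) w, come from the integer parts of the factors l, ..., l+3. *)
have H : hyp_coef j.+1 * ((1 - z ^+ j.+1) ^+ 2 * (l%:R + log_coef j.+1)
          + 2 * z ^+ j.+1 ^+ 2 - 2 * z ^+ j.+1) =
    hyp_coef j * z ^+ j.+1 ^+ 2 * ((1 + (k%:R - 1) * z ^+ j.+1) *
      (l%:R + log_coef j) + 2 + 3 * (k%:R - 1) * z ^+ j.+1).
  rewrite hyp_coefS log_coefS; move: u1 u2.
  move: (z ^+ j.+1) (k%:R - 1) (hyp_coef j) (log_coef j) => w e c s u1 u2.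
  have Hp := mulrV u1; have Hv := mulrV u2; rewrite -exprVn.
  move: ((1 - w)^-1) ((1 + e * w)^-1) Hp Hv => p v Hp Hv.
  (* [P] equals 1. Inserting its powers makes both sides agree as polynomials in [p] and [v], which
     [ring] can check before the inverse relations are used. *)
  pose P := (1 - w) * p.
  transitivity (c * w ^+ 2 * (P ^+ 2 * (1 + e * w) * (l%:R + s + 1)
    + 2 * P ^+ 2 * p * (1 + e * w) - P ^+ 2 * ((1 + e * w) * v)
    - 2 * w * p * P * (1 + e * w))); first by rewrite /P; ring.
  rewrite /P Hp Hv.
  transitivity (c * w ^+ 2 * ((1 + e * w) * (l%:R + s + 1)
    + 2 * (1 + e * w) * ((1 - w) * p) - 1)); first by ring.
  by rewrite Hp; ring.
rewrite ![(_ * j.+1)%N]mulnS ![(_ .+3 * j)%N]mulSn ![(_ .+2 * j)%N]mulSn.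
rewrite ![(_ .+1 * j)%N]mulSn.
transitivity (z ^+ l * z ^+ (l * j) *
  (hyp_coef j.+1 * ((1 - z ^+ j.+1) ^+ 2 * (l%:R + log_coef j.+1)
          + 2 * z ^+ j.+1 ^+ 2 - 2 * z ^+ j.+1))).
  rewrite -[l.+2]addn2 -[l.+1]addn1 !natrD !exprD.
  by rewrite !exprS; ring.
by rewrite H -[l.+3]addn3 -[l.+2]addn2 !natrD !exprD !exprS; ring.
Qed.

(** * The platform system and its solution *)

Definition platform_eq (X : nat -> fps rat) (l : nat) :=
  X l = 1 + \sum_(1 <= m < l.+2) (stack_num k l m)%:R * (z ^+ m * X m).

(** The right side involves [X l] and [X l.+1] themselves, but every unknown carries a factor z^m
    with m >= 1. Coefficient n is therefore fixed by smaller coefficients, and strong induction on n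
    works for all [l] at once. *)
Lemma platform_eq_unique (X Y : nat -> fps rat) :
  (forall l, (0 < l)%N -> platform_eq X l) ->
  (forall l, (0 < l)%N -> platform_eq Y l) ->
  forall l, (0 < l)%N -> X l = Y l.
Proof.
move=> EX EY l l0; apply: fpsP => n.
elim/ltn_ind: n l l0 => n IH l l0.
rewrite (EX l l0) (EY l l0) !fps_coefD; congr (_ + _).
rewrite !fps_coef_sum !big_nat; apply: eq_bigr => m /andP[m0 _].
rewrite !fps_coef_natM !fps_coefXnM; case: leqP => // mn.
by rewrite IH // ltn_subrL m0 (leq_trans m0 mn).
Qed.

Lemma stack_num_natr l m : (0 < k)%N -> (m < l.+2)%N ->
  (stack_num k l m)%:R = (l.+2 - m)%:R * k%:R - 1 :> fps rat.
Proof.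
move=> k0 ml; have p0 : (0 < (l.+2 - m) * k)%N by rewrite muln_gt0 subn_gt0 ml.
by rewrite -natrM -(prednK p0) mulrS addrAC subrr add0r.
Qed.

(** The two initial conditions are the system at l = 1 and the difference of its instances at l = 2
    and l = 1. Summing the second-order recurrence twice from there gives the system for every
    [l]. *)
Lemma platform_eq_of_rec (X : nat -> fps rat) : (0 < k)%N -> tower_rec X ->
  X 1%N = 1 + (2 * k%:R - 1) * z * X 1%N + (k%:R - 1) * z ^+ 2 * X 2%N ->
  X 2%N - X 1%N = k%:R * (z * X 1%N + z ^+ 2 * X 2%N)
                  + (k%:R - 1) * z ^+ 3 * X 3%N ->
  forall l, (0 < l)%N -> platform_eq X l.
Proof.
move=> k0 recX X1 X2.
have Xdiff l : (0 < l)%N -> X l.+1 - X l =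
    k%:R * \sum_(1 <= m < l.+2) (z ^+ m * X m) + (k%:R - 1) * z ^+ l.+2 * X l.+2.
  case: l => // l _; elim: l => [|l IH].
    by rewrite X2 big_nat_recr //= big_nat1 expr1.
  (* The added z^(l+3) X_(l+3) completes the last coefficient k - 1 of the induction hypothesis to
     k, so that this term joins the sum. *)
  have -> : X l.+3 - X l.+2 = (X l.+2 - X l.+1) + z ^+ l.+3 * X l.+3
      + (k%:R - 1) * z ^+ l.+4 * X l.+4.
    by rewrite -addrA -(recX l.+1); ring.
  by rewrite IH [in RHS]big_nat_recr //=; ring.
case=> // l _; elim: l => [|l IH].
  rewrite /platform_eq {1}X1 big_nat_recr //= big_nat1 !stack_num_natr //.
  by rewrite expr1 !subSS !subn0; ring.
rewrite /platform_eq -[LHS](subrK (X l.+1)) Xdiff // [X in _ + X]IH.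
rewrite [in RHS]big_nat_recr //= stack_num_natr // subSn // subnn.
(* Widening the platform by [k] columns adds [k] placements for each row length that already fitted;
   the new longest row contributes the separate term with coefficient k - 1. *)
rewrite [X in _ = _ + (X + _)](eq_big_nat _ _ (F2 := fun m =>
    (stack_num k l.+1 m)%:R * (z ^+ m * X m) + k%:R * (z ^+ m * X m))); last first.
  move=> m /andP[_ ml]; rewrite !stack_num_natr ?(leqW ml) // subSn; last exact: ltnW.
  by rewrite -[(_ - _).+1]addn1 natrD; ring.
by rewrite big_split /= -mulr_sumr; ring.
Qed.

Lemma hyp_coef_coef0 j : fps_coef (hyp_coef j.+1) 0 = 0.
Proof.
by rewrite /hyp_coef /h !fps_coefM0 (@fps_val_ge_fpsXn _ (j.+1 * (j.+1 + 1))) ?mul0r // addn1.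
Qed.

Lemma hyp_coef0 : hyp_coef 0 = 1.
Proof. by rewrite /hyp_coef /h /qpoch !big_ord0 !mul1r expr1n invr1. Qed.

Lemma A_coef0 l : fps_coef (A k l) 0 = 1.
Proof.
rewrite (fps_has_sum_coef0 (A_has_sum k l)) => [|j].
  by rewrite A_termE hyp_coef0 muln0 mulr1.
by rewrite A_termE fps_coefM0 hyp_coef_coef0 mulr0.
Qed.

Lemma B_coef0 l : fps_coef (B k l) 0 = l%:R.
Proof.
rewrite (fps_has_sum_coef0 (B_has_sum k l)) => [|j].
  rewrite B_termE hyp_coef0 muln0 !mul1r /log_coef big_geq // addr0.
  by rewrite -[l%:R]mulr1 fps_coef_natM mulr1.
by rewrite B_termE fps_coefM0 fps_coefM0 hyp_coef_coef0 mulr0 mul0r.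
Qed.

Lemma tower_rec_comb (X Y : nat -> fps rat) a b :
  tower_rec X -> tower_rec Y -> tower_rec (fun l => a * X l + b * Y l).
Proof.
move=> rX rY l.
transitivity (a * (X l.+2 - 2 * X l.+1 + X l) + b * (Y l.+2 - 2 * Y l.+1 + Y l)).
  by ring.
by rewrite rX rY; ring.
Qed.

Lemma platform_eq_solution (X : nat -> fps rat) : (0 < k)%N ->
  (forall l, (0 < l)%N -> platform_eq X l) ->
  forall l, (0 < l)%N -> X l =
      ((1 + k%:R * z) * T k 1 l + (k%:R * z ^+ 2 - 1) * T k 2 l
         + (k%:R - 1) * z ^+ 3 * T k 3 l)
      / ((1 - (2 * k%:R - 1) * (1 + z) * z + k%:R ^+ 2 * z ^+ 3) * T k 1 2
         + (k%:R - 1) * ((2 * k%:R - 1) * z - 1) * z ^+ 3 * T k 1 3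
         + (k%:R - 1) ^+ 2 * z ^+ 5 * T k 2 3).
Proof.
move=> k0 EX.
set D := (X in X^-1).
(* The constant term of [D] is that of [T k 1 2], namely 1 * 2 - 1 * 1. *)
have uD : D \is a GRing.unit.
  suff: fps_coef D 0 \is a GRing.unit by [].
  have -> : D = T k 1 2 + z * ((- (2 * k%:R - 1) * (1 + z) + k%:R ^+ 2 * z ^+ 2)
      * T k 1 2 + (k%:R - 1) * ((2 * k%:R - 1) * z - 1) * z ^+ 2 * T k 1 3
      + (k%:R - 1) ^+ 2 * z ^+ 4 * T k 2 3) by rewrite /D; ring.
  rewrite fps_coefD [in X in _ + X]fps_coefM0 mul0r addr0.
  rewrite /T fps_coefD fps_coefN !fps_coefM0 !A_coef0 !B_coef0 !mul1r.
  by rewrite (_ : 2%:R - 1%:R = 1 :> rat) ?unitr1.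
apply: platform_eq_unique EX _.
(* Expanding [T] exhibits the quotient as a combination of [A k l] and [B k l] whose coefficients do
   not depend on [l], hence as a solution of the recurrence. *)
have XE l : ((1 + k%:R * z) * T k 1 l + (k%:R * z ^+ 2 - 1) * T k 2 l
         + (k%:R - 1) * z ^+ 3 * T k 3 l) / D =
   - ((1 + k%:R * z) * B k 1 + (k%:R * z ^+ 2 - 1) * B k 2
         + (k%:R - 1) * z ^+ 3 * B k 3) / D * A k l
   + ((1 + k%:R * z) * A k 1 + (k%:R * z ^+ 2 - 1) * A k 2
         + (k%:R - 1) * z ^+ 3 * A k 3) / D * B k l.
  by rewrite /T; move: (D^-1) => D'; ring.
apply: platform_eq_of_rec => //.
- by rewrite (funext XE); apply: tower_rec_comb; [exact: A_rec | exact: B_rec].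
(* [D] is exactly N_1 - (2k-1) z N_1 - (k-1) z^2 N_2, where N_l is the numerator at [l]; dividing by
   [D] normalises this to 1. *)
- move: (mulrV uD); rewrite {1}/D; move: (D^-1) => D' H.
  by rewrite -[X in _ = X + _ + _]H /T; ring.
(* This condition is the vanishing of (1+kz) X_1 + (k z^2 - 1) X_2 + (k-1) z^3 X_3. The numerator
   applies the same linear form to the first index of [T], so it holds by antisymmetry. *)
- by move: (D^-1) => D'; rewrite /T; ring.
Qed.

End Recurrence.

(** * Decomposition of towers *)

(** The counting principle for a disjoint union of injective images. Finiteness of [W] is proved
    along with the count because [num] sends an infinite set to 0. *)
Lemma num_bigcup (I : eqType) (U V : choiceType) (s : seq I)
    (S : I -> set U) (E : I -> U -> V) (W : set V) :
  uniq s -> (forall i, i \in s -> finite_set (S i)) ->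
  (forall i j x y, i \in s -> j \in s -> S i x -> S j y ->
     E i x = E j y -> i = j /\ x = y) ->
  (forall v, W v <-> exists i x, [/\ i \in s, S i x & v = E i x]) ->
  finite_set W /\ num W = (\sum_(i <- s) num (S i))%N.
Proof.
move=> us finS injE WE.
pose t := [seq E i x | i <- s, x <- fset_set (S i) : seq U].
have mem_t v : v \in t <-> W v.
  rewrite WE; split=> [/allpairsPdep[i [x [si xS ->]]]|[i [x [si xS ->]]]].
    by exists i, x; split=> //; move: xS; rewrite in_fset_set ?inE //; apply: finS.
  by apply/allpairsPdep; exists i, x; split=> //; rewrite in_fset_set ?inE //; apply: finS.
have ut : uniq t.
  apply: allpairs_uniq_dep => //.
  move=> _ _ /allpairsPdep[i [x [si xS ->]]] /allpairsPdep[j [y [sj yS ->]]] /=.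
  rewrite !in_fset_set ?inE in xS yS; try exact: finS.
  by move=> /(injE _ _ _ _ si sj xS yS) [-> ->].
have finW : finite_set W.
  suff -> : W = [set` t] by apply: finite_seq.
  by apply/seteqP; split=> v /=; rewrite mem_t.
split=> //; rewrite /num.
have -> : fset_set W = [fset x in t]%fset.
  apply/fsetP => v; rewrite in_fset_set // !inE /=.
  by apply/idP/idP; rewrite inE => /mem_t.
by rewrite card_fseq undup_id // size_allpairs_dep sumnE big_map.
Qed.

Section Towers.
Variable k : nat.
Hypothesis k0 : (0 < k)%N.
Implicit Types (T U : {fset block}) (b : block) (r l m n : nat) (a c x : int).

Lemma contiguous_tiling T r : non_overlapping k T ->
  contiguous (row_cols k T r) -> (exists c, (r, c) \in T) ->
  exists a m, (0 < m)%N /\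
    forall c, (r, c) \in T <-> exists2 i : nat, (i < m)%N & c = a + (i * k)%N%:Z.
Proof.
move=> noT [a [e rowE]] [c0 c0T].
have inrow c x : (r, c) \in T -> c <= x < c + k%:Z -> a <= x < e.
  move=> cT cx; have : row_cols k T r x by exists (r, c).
  by rewrite rowE.
have cover x : a <= x < e -> exists2 c, (r, c) \in T & c <= x < c + k%:Z.
  move=> ax; have : row_cols k T r x by rewrite rowE.
  by case=> -[r' c] cT /= [rr cx]; exists c => //; rewrite -rr.
have disj c c' x : (r, c) \in T -> (r, c') \in T ->
    c <= x < c + k%:Z -> c' <= x < c' + k%:Z -> c = c'.
  move=> cT cT' cx cx'; apply/eqP/negP => /negP cc'.
  suff : (block_cols k (r, c) `&` block_cols k (r, c')) x.
    by rewrite noT //=; apply: contra cc' => /eqP [->].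
  by [].
(* The block covering column a + (i+1) k cannot start further left, since it would then overlap the
   block starting at a + i k. *)
have tile i : a + (i * k)%N%:Z < e -> (r, a + (i * k)%N%:Z) \in T.
  elim: i => [|i IH] lt_e.
    have [|c cT cx] := cover a; first by lia.
    have := inrow c c cT; suff -> : a + (0 * k)%N%:Z = c by [].
    by have := inrow c c cT; lia.
  have [|c cT cx] := cover (a + (i.+1 * k)%N%:Z); first by lia.
  have iT : (r, a + (i * k)%N%:Z) \in T by apply: IH; lia.
  have [<-//|lt_c] := eqVneq c (a + (i.+1 * k)%N%:Z).
  have := disj c _ c cT iT; lia.
have c0e : a <= c0 < e by apply: (inrow c0 c0 c0T); lia.
pose d := `|e - a|%N; have ed : e = a + d%:Z by rewrite /d; lia.
(* The number of blocks is d / k rounded up: i is below it exactly when i k <= d - 1, that is, when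
   block i starts before [e]. *)
exists a, (d.-1 %/ k).+1; split=> // c; split=> [cT|[i]]; last first.
  by rewrite ltnS leq_divRL // => im ->; apply: tile; lia.
have ac : a <= c < e by apply: (inrow c c cT); lia.
pose p := `|c - a|%N; have cp : c = a + p%:Z by rewrite /p; lia.
have := divn_eq p k; have := ltn_pmod p k0 => pm pE.
exists (p %/ k)%N; first by rewrite ltnS leq_divRL //; lia.
(* Tile number p / k contains column [c], so it is the block starting at [c]. *)
by apply: (disj c _ c cT); [apply: tile; lia|lia|lia].
Qed.

(** * Translating, raising and adding a bottom row *)

Lemma in_translate c T b : (b \in translate c T) = ((b.1, b.2 - c) \in T).
Proof.
apply/imfsetP/idP => /= [[b' b'T ->]|bT]; first by rewrite /= addrK -surjective_pairing.
by exists (b.1, b.2 - c) => //=; rewrite subrK -surjective_pairing.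
Qed.

Lemma translateD c c' T : translate c (translate c' T) = translate (c + c') T.
Proof. by apply/fsetP => b; rewrite !in_translate /= opprD addrA. Qed.

Lemma translate0 T : translate 0 T = T.
Proof. by apply/fsetP => b; rewrite in_translate subr0 -surjective_pairing. Qed.

Lemma card_translate c T : #|` translate c T|%fset = #|` T|%fset.
Proof.
by apply: card_imfset => -[r x] [r' x'] /= [-> /addIr ->].
Qed.

Lemma row_cols_translate c T r :
  row_cols k (translate c T) r = [set x | row_cols k T r (x - c)].
Proof.
apply/seteqP; split=> x [b]; rewrite /block_cols /=.
  rewrite in_translate => bT [br bx]; exists (b.1, b.2 - c) => //=; split=> //.
  by rewrite /block_cols /=; lia.
move=> bT [br bx]; exists (b.1, b.2 + c) => /=; last by rewrite /block_cols /=; split=> //; lia.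
by rewrite in_translate /= addrK -surjective_pairing.
Qed.

Definition raise T : {fset block} := [fset ((b.1.+1, b.2) : block) | b in T]%fset.

Lemma in_raise T r c : ((r, c) \in raise T) = (0 < r)%N && ((r.-1, c) \in T).
Proof.
apply/imfsetP/idP => /= [[b bT [-> ->]]|/andP[r0 bT]].
  by rewrite /= -surjective_pairing.
by exists (r.-1, c); rewrite //= prednK.
Qed.

Lemma raise_inj : injective raise.
Proof.
move=> T U eqTU; apply/fsetP => -[r c].
by have := in_raise T r.+1 c; rewrite eqTU in_raise.
Qed.

(** The added row occupies exactly the columns of a platform of width [m * k], so it can replace the
    platform under [T]. *)
Definition base m T : {fset block} :=
  ([fset ((0%N, (i * k)%N%:Z) : block) | i in iota 0 m] `|` T)%fset.

Lemma in_base m T b : reflect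
  ((b.1 = 0%N /\ exists2 i : nat, (i < m)%N & b.2 = (i * k)%N%:Z) \/ b \in T)
  (b \in base m T).
Proof.
rewrite in_fsetU; apply: (iffP orP) => -[bT|bT]; [left|by right|left|by right].
  by have /imfsetP[i /= + ->] := bT; rewrite mem_iota => /= im; split=> //; exists i.
case: bT => b1 [i im b2]; apply/imfsetP; exists i; first by rewrite /= mem_iota.
by rewrite -b1 -b2 -surjective_pairing.
Qed.

Definition above_ground T := forall b, b \in T -> (0 < b.1)%N.

Lemma card_base m T : above_ground T -> #|` base m T|%fset = (m + #|` T|%fset)%N.
Proof.
move=> T0; rewrite cardfsU (_ : _ `&` T = fset0)%fset; last first.
  apply/fsetP => b; rewrite in_fsetI in_fset0; apply/negP => /andP[/imfsetP[i _ ->]].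
  by move/T0.
rewrite cardfs0 subn0 card_imfset ?size_iota //=.
  by rewrite undup_id ?iota_uniq ?size_iota.
by move=> i j [] /eqP; rewrite eqn_pmul2r // => /eqP.
Qed.

Definition towers n : set {fset block} :=
  [set T | [/\ is_tower k T, row_convex k T & #|` T|%fset = n]].

Definition platform_towers l n : set {fset block} :=
  [set T | [/\ is_platform_tower k l T, row_convex k T & #|` T|%fset = n]].

Lemma translate_tower c n T : towers n T -> towers n (translate c T).
Proof.
case=> -[T0 noT T1 T2] cvT cardT; split; last by rewrite card_translate.
  split.
  - by rewrite -cardfs_gt0 card_translate cardfs_gt0.
  - move=> b b'; rewrite !in_translate => bT bT' eqr neqb.
    have neq' : ((b.1, b.2 - c) : block) != (b'.1, b'.2 - c).
      apply: contra neqb => /eqP[e1 /addIr e2]; apply/eqP.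
      by rewrite [b]surjective_pairing e1 e2 -surjective_pairing.
    have no := noT _ _ bT bT' eqr neq'; apply/seteqP; split=> // x [bx bx'].
    suff : set0 (x - c) by [].
    by rewrite -no; rewrite /block_cols /= in bx bx' *; split=> /=; lia.
  - rewrite row_cols_translate; have [a [e ->]] := T1; exists (a + c), (e + c).
    by apply/seteqP; split=> x /=; lia.
  - move=> b; rewrite in_translate => bT b1.
    have [b' bT' [eqr [x [bx bx']]]] := T2 _ bT b1.
    exists (b'.1, b'.2 + c); first by rewrite in_translate /= addrK -surjective_pairing.
    split=> //; exists (x + c); rewrite /block_cols /= in bx bx' *.
    by split=> /=; lia.
move=> r; rewrite row_cols_translate; have [a [e ->]] := cvT r; exists (a + c), (e + c).
by apply/seteqP; split=> x /=; lia.
Qed.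

Lemma row_cols_base0 m T : above_ground T ->
  row_cols k (base m T) 0 = platform_cols k m.
Proof.
move=> T0; apply/seteqP; split=> x.
  case=> b /in_base[[_ [i im b2]]|/T0 b0 []]; last by move=> br; rewrite br in b0.
  case=> _; rewrite /block_cols /platform_cols /= b2.
  by have : (i * k + k <= m * k)%N; [rewrite -mulSnr leq_mul2r im orbT|lia].
rewrite /platform_cols /= => xm; case: x xm => // x xm.
exists (0%N, (x %/ k * k)%N%:Z); first apply/in_base; last split=> //.
  left; split=> //; exists (x %/ k)%N => //; rewrite ltn_divLR //; lia.
by rewrite /block_cols /=; have := divn_eq x k; have := ltn_pmod x k0; lia.
Qed.

Lemma row_cols_baseS m T r : row_cols k (base m T) r.+1 = row_cols k T r.+1.
Proof.
apply/seteqP; split=> x [b].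
  by move=> /in_base[[b1 _]|bT]; [rewrite b1; case|exists b].
by move=> bT bx; exists b => //; apply/in_base; right.
Qed.

Lemma base_tower m n T : (0 < m)%N ->
  platform_towers m n T -> towers (m + n) (base m T).
Proof.
move=> m0 [[T0 noT T1 T2] cvT cardT].
have cv0 : contiguous (row_cols k (base m T) 0).
  by rewrite row_cols_base0 //; exists 0, (m * k)%N%:Z.
split; last by rewrite card_base // cardT.
  split=> //.
  - by rewrite -cardfs_gt0 card_base // addn_gt0 m0.
  - move=> b b' /in_base[[b1 [i im b2]]|bT] /in_base[[b1' [i' im' b2']]|bT'].
    + case: b b' b1 b2 b1' b2' => r c [r' c'] /= -> -> -> -> _ neqb.
      have neqi : i != i' by apply: contra neqb => /eqP ->.
      apply/seteqP; split=> // x []; rewrite /block_cols /= => bx bx'.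
      have [lt_ii'|lt_i'i|eqi] := ltngtP i i'; last by rewrite eqi eqxx in neqi.
        by have : (i * k + k <= i' * k)%N; [rewrite -mulSnr leq_mul2r lt_ii' orbT|lia].
      by have : (i' * k + k <= i * k)%N; [rewrite -mulSnr leq_mul2r lt_i'i orbT|lia].
    + by move=> eqr; have := T0 _ bT'; rewrite -eqr b1.
    + by move=> eqr; have := T0 _ bT; rewrite eqr b1'.
    + exact: noT.
  - move=> b /in_base[[b1 _]|bT]; first by rewrite b1.
    rewrite leq_eqVlt => /predU1P[b1|b1].
      have [x [bx mx]] := T1 _ bT (esym b1).
      rewrite -(row_cols_base0 m T0) in mx; have [b' bT' [b0 bx']] := mx.
      by exists b' => //; split; [rewrite b0|exists x].
    have [b' bT' bb'] := T2 _ bT b1; exists b' => //.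
    by apply/in_base; right.
by case=> // r; rewrite row_cols_baseS.
Qed.

(** The bottom row alone determines [a] as its leftmost start and [m] as its length; undoing the
    translation then recovers the rows above. *)
Lemma translate_base_inj a a' m m' T T' : (0 < m)%N -> (0 < m')%N ->
  above_ground T -> above_ground T' ->
  translate a (base m T) = translate a' (base m' T') ->
  [/\ a = a', m = m' & T = T'].
Proof.
move=> m0 m0' T0 T0' eqT.
have mem0 a1 m1 T1 c : above_ground T1 -> (0%N, c) \in translate a1 (base m1 T1) <->
    exists2 i : nat, (i < m1)%N & c = a1 + (i * k)%N%:Z.
  move=> T10; rewrite in_translate; split=> /=.
    case/in_base=> [[_ [i im /= ci]]|/T10 //].
    by exists i => //; lia.
  by case=> i im ci; apply/in_base; left; split=> //; exists i => //=; lia.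
have rowE c : (exists2 i : nat, (i < m)%N & c = a + (i * k)%N%:Z) <->
    (exists2 i : nat, (i < m')%N & c = a' + (i * k)%N%:Z).
  split=> [/(mem0 a m T c T0)|/(mem0 a' m' T' c T0')]; first by rewrite eqT => /mem0; apply.
  by rewrite -eqT => /mem0; apply.
(* Each of [a] and [a'] is the other plus a nonnegative multiple of [k], so they are equal.
   Comparing the last blocks of the two rows likewise gives [m = m']. *)
have [i _ ai] : exists2 i : nat, (i < m')%N & a = a' + (i * k)%N%:Z.
  by apply/rowE; exists 0%N => //; lia.
have [i' _ ai'] : exists2 i : nat, (i < m)%N & a' = a + (i * k)%N%:Z.
  by apply/rowE; exists 0%N => //; lia.
have eqa : a = a' by lia.
rewrite {}eqa {ai ai' i i'} in eqT rowE *.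
have [i im ai] : exists2 i : nat, (i < m')%N & a' + (m.-1 * k)%N%:Z = a' + (i * k)%N%:Z.
  by apply/rowE; exists m.-1 => //; lia.
have [i' im' ai'] : exists2 i : nat, (i < m)%N & a' + (m'.-1 * k)%N%:Z = a' + (i * k)%N%:Z.
  by apply/rowE; exists m'.-1 => //; lia.
split=> //; first by nia.
apply/fsetP => -[[|r] c].
  by apply/idP/idP => [/T0|/T0'].
have in_baseS m1 T1 : (r.+1, c) \in T1 <-> (r.+1, c + a') \in translate a' (base m1 T1).
  rewrite in_translate /= addrK; split=> [bT|/in_base[[]|] //].
  by apply/in_base; right.
by apply/idP/idP => [/(in_baseS m)|/(in_baseS m')]; [rewrite eqT|rewrite -eqT] => /in_baseS.
Qed.

Lemma tower_decomp n U : towers n U -> exists a m T,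
  [/\ (0 < m <= n)%N, platform_towers m (n - m) T & U = translate a (base m T)].
Proof.
move=> tU; have [[U0 noU U1 U2] cvU cardU] := tU.
(* Following supports downwards from any block of the nonempty tower reaches row 0. *)
have [c cU] : exists c, (0%N, c) \in U.
  have [[r x] bU] := fset0Pn _ U0.
  elim: r x bU => [|r IH] x bU; first by exists x.
  have [[r' x'] bU' [/= [eqr] _]] := U2 _ bU erefl.
  by apply: (IH x'); rewrite -eqr.
have [a [m [m0 rowE]]] := contiguous_tiling noU U1 (ex_intro _ c cU).
pose T : {fset block} := [fset b in translate (- a) U | (0 < b.1)%N]%fset.
have in_T b : (b \in T) = (b \in translate (- a) U) && (0 < b.1)%N.
  by rewrite !inE.
have UE : translate (- a) U = base m T.
  apply/fsetP => b; apply/idP/in_base => [bU|[[b0 [i im b2]]|]]; last first.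
  - by rewrite in_T => /andP[].
  - by rewrite in_translate b0; apply/rowE; exists i => //; lia.
  - rewrite in_T bU; case: (posnP b.1) => [b0|]; last by right.
    left; split=> //; move: bU; rewrite in_translate b0 => /rowE[i im bi].
    by exists i => //; lia.
exists a, m, T; rewrite -UE translateD subrr translate0.
have T0 : above_ground T by move=> b; rewrite in_T => /andP[].
have := translate_tower (- a) tU; rewrite UE => -[[_ noB B1 B2] cvB].
rewrite card_base // => cardT; split=> //; first by rewrite m0 -cardT leq_addr.
split; last by rewrite -cardT addKn.
  have TB b : b \in T -> b \in base m T by move=> bT; apply/in_base; right.
  split=> //.
  - by move=> b b' bT bT'; apply: noB; apply: TB.
  - move=> b bT b1; have [b' bB [eqr [x [bx bx']]]] := B2 _ (TB _ bT) (T0 _ bT).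
    exists x; split=> //; rewrite -(row_cols_base0 m T0); exists b' => //.
    by move: eqr; rewrite b1 => -[].
  - move=> b bT b1; have [b' /in_base[[b0 _]|bT'] [eqr sh]] := B2 _ (TB _ bT) (T0 _ bT).
      by move: b1; rewrite -eqr b0.
    by exists b'.
case=> [|r]; last by rewrite -(row_cols_baseS m); apply: cvB.
(* Row 0 of [T] is empty, which is the degenerate interval from 0 to 0. *)
exists 0, 0; apply/seteqP; split=> x /=; last by lia.
by case=> b /T0 + [b0]; rewrite b0.
Qed.

(** * Raising a tower onto a platform *)

Lemma row_cols_raiseS U r : row_cols k (raise U) r.+1 = row_cols k U r.
Proof.
apply/seteqP; split=> x [[r' c] + [/= br bx]].
  by rewrite br in_raise /= => bU; exists (r, c).
by rewrite br => bU; exists (r.+1, c); rewrite ?in_raise.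
Qed.

Lemma card_raise U : #|` raise U|%fset = #|` U|%fset.
Proof. by apply: card_imfset => -[r x] [r' x'] /= [-> ->]. Qed.

Lemma share_platform l c : (0 < l)%N ->
  share_column (block_cols k (0%N, c)) (platform_cols k l) <->
  - k%:Z < c < (l * k)%N%:Z.
Proof.
move=> l0; have lk0 : (0 < l * k)%N by rewrite muln_gt0 l0.
rewrite /share_column /block_cols /platform_cols; split=> [[x [/= cx xl]]|cl].
  by lia.
(* The witness is max(0, c), the first common column. *)
by exists (if 0 <= c then c else 0); split=> /=; case: ifP; lia.
Qed.

Lemma raise_platform l n U : (0 < l)%N -> towers n U ->
  platform_towers l n (raise U) <->
  (forall c, (0%N, c) \in U -> - k%:Z < c < (l * k)%N%:Z).
Proof.
move=> l0 [[U0 noU U1 U2] cvU cardU]; split=> [[[_ _ R1 _] _ _] c cU|share0].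
  apply/share_platform => //.
  by have := R1 (1%N, c); apply=> //; rewrite in_raise.
split; last by rewrite card_raise.
  split.
  - by case=> r c; rewrite in_raise => /andP[].
  - move=> [r c] [r' c']; rewrite !in_raise /= => /andP[r0 bU] /andP[_ bU'] eqr.
    rewrite -eqr in bU' * => neqb; apply: noU bU bU' erefl _.
    by apply: contra neqb => /eqP[->].
  - move=> [r c]; rewrite in_raise /= => + r1; rewrite r1 /= => bU.
    exact/(share_platform c l0)/share0.
  - move=> [r c]; rewrite in_raise /= => /andP[r0 bU] r2.
    have [|[r' c'] bU' [/= eqr sh]] := U2 _ bU; first by rewrite /=; lia.
    by exists (r'.+1, c'); rewrite ?in_raise //=; split=> //; lia.
case=> [|r]; last by rewrite row_cols_raiseS.
exists 0, 0; apply/seteqP; split=> x /=; last by lia.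
by case=> -[r c]; rewrite in_raise => /andP[/= r0 _] [/= rr]; rewrite rr in r0.
Qed.

Lemma platform_lower l n T : platform_towers l n.+1 T ->
  exists2 U, towers n.+1 U & T = raise U.
Proof.
move=> [[T0 noT T1 T2] cvT cardT].
pose U : {fset block} := [fset ((b.1.-1, b.2) : block) | b in T]%fset.
have TU : T = raise U.
  apply/fsetP => -[r c]; rewrite in_raise; apply/idP/idP => [bT|/andP[r0 /imfsetP[b bT]]].
    by rewrite (T0 _ bT) /=; apply/imfsetP; exists (r, c).
  have b0 := T0 _ bT; case=> rb ->; rewrite (_ : r = b.1) -?surjective_pairing //.
  by rewrite -(prednK r0) rb prednK.
have in_U r c : ((r, c) \in U) = ((r.+1, c) \in T) by rewrite TU in_raise.
exists U => //; split; last by rewrite -card_raise -TU.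
  split.
  - by rewrite -cardfs_gt0 -card_raise -TU cardT.
  - move=> [r c] [r' c']; rewrite !in_U /= => bT bT' eqr neqb.
    rewrite eqr in bT neqb *.
    by apply: noT bT bT' erefl _; apply: contra neqb => /eqP[->].
  - by rewrite -row_cols_raiseS -TU; apply: cvT.
  - move=> [r c]; rewrite in_U /= => bT r1.
    have [//|[r' c'] bT' [/= [eqr] sh]] := T2 _ bT.
    exists (r'.-1, c'); last by split; rewrite //= prednK // (T0 _ bT').
    by rewrite in_U prednK // (T0 _ bT').
by move=> r; rewrite -row_cols_raiseS -TU; apply: cvT.
Qed.

(** Row 1 of a nonempty platform tower is the bottom row of a raised tower, so it is described by
    its length [m] and its offset, and the rest stands on it as on a platform. Finiteness is a
    hypothesis here so that the induction on the number of blocks can supply it. *)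
Lemma platform_towers_rec l n :
  (0 < l)%N -> (forall m, (0 < m <= n.+1)%N -> finite_set (platform_towers m (n.+1 - m))) ->
  finite_set (platform_towers l n.+1) /\
  f k l n.+1 = (\sum_(1 <= m < n.+2) stack_num k l m * f k m (n.+1 - m))%N.
Proof.
move=> l0 fin.
(* [d] counts placements from the leftmost one: at d = 0 the first block starts in column -(k-1) and
   touches only column 0 of the platform. *)
pose s := [seq (m, d) | m <- index_iota 1 n.+2, d <- iota 0 (stack_num k l m)].
have mem_s m d : ((m, d) \in s) = (0 < m <= n.+1)%N && (d < stack_num k l m)%N.
  apply/allpairsPdep/andP => [[m' [d' []]]|[m1 d1]].
    by rewrite mem_index_iota mem_iota ltnS => m1 d1 [-> ->].
  by exists m, d; rewrite mem_index_iota mem_iota ltnS.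
have [] := @num_bigcup _ _ _ s (fun p => platform_towers p.1 (n.+1 - p.1))
  (fun p T => raise (translate (p.2%:Z - k.-1%:Z) (base p.1 T))) (platform_towers l n.+1).
- apply: allpairs_uniq_dep => [|m _|[m d] [m' d'] _ _ [-> ->]] //.
    exact: iota_uniq.
  exact: iota_uniq.
- by move=> [m d]; rewrite mem_s => /andP[m0 _]; apply: fin.
- move=> [m d] [m' d'] T T'; rewrite !mem_s /= => /andP[/andP[m0 _] _] /andP[/andP[m0' _] _].
  move=> [[T0 _ _ _] _ _] [[T0' _ _ _] _ _] /raise_inj /(translate_base_inj m0 m0' T0 T0').
  by case=> eqd -> ->; split=> //; congr (_, _); lia.
(* Only the two end blocks of the row matter: the first gives the left bound and the last gives the
   right bound. *)
- have bound a m T : (0 < m)%N -> above_ground T ->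
      (forall c, (0%N, c) \in translate a (base m T) -> - k%:Z < c < (l * k)%N%:Z) <->
      (- k%:Z < a /\ a + (m.-1 * k)%N%:Z < (l * k)%N%:Z).
    move=> m0 T0; split=> [ba|[a1 a2] c].
      split; first by have [|] := andP (ba a _); rewrite // in_translate subrr; apply/in_base;
        left; split=> //; exists 0%N.
      have [|//] := andP (ba (a + (m.-1 * k)%N%:Z) _).
      rewrite in_translate addrAC subrr add0r; apply/in_base.
      by left; split=> //; exists m.-1 => //; rewrite prednK.
    rewrite in_translate => /in_base[[_ [i im /= ci]]|/T0 //].
    have : (i * k <= m.-1 * k)%N by rewrite leq_mul2r; apply/orP; right; lia.
    by lia.
  have k1 : k.-1%:Z = k%:Z - 1 by lia.
  have stackE m d : (0 < m)%N -> (d < stack_num k l m)%N <->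
      (d%:Z - k.-1%:Z + (m.-1 * k)%N%:Z < (l * k)%N%:Z).
    move=> m0; have mk : (m * k = m.-1 * k + k)%N by rewrite -mulSnr prednK.
    rewrite /stack_num mulnBl !mulSn.
    by have : (m.-1 * k <= l * k)%N \/ (l * k < m.-1 * k)%N; lia.
  move=> v; split=> [|[[m d] [T [+ + ->]]]] /=.
    move=> vP; have [U tU vU] := platform_lower vP; rewrite vU in vP *.
    have [a [m [T [/andP[m0 mn] PT UE]]]] := tower_decomp tU.
    have := (raise_platform l0 tU).1 vP; rewrite UE => /bound.
    have [[T0 _ _ _] _ _] := PT; case=> // a1 a2.
    exists (m, absz (a + k.-1%:Z)), T; split=> //=.
      rewrite mem_s m0 mn /=; apply/stackE => //; lia.
    by congr (raise (translate _ _)); lia.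
  rewrite mem_s => /andP[/andP[m0 mn] ds] PT.
  have tU := translate_tower (d%:Z - k.-1%:Z) (base_tower m0 PT).
  rewrite subnKC // in tU; apply/(raise_platform l0 tU)/bound => //.
    by have [[]] := PT.
  by split; [lia|apply/stackE].
move=> finW numW; split=> //; rewrite /f numW big_allpairs_dep.
by apply: eq_big_nat => m _ /=; rewrite big_const_seq count_predT size_iota iter_addn_0 mulnC.
Qed.

Lemma finite_platform_towers l n : (0 < l)%N -> finite_set (platform_towers l n).
Proof.
elim/ltn_ind: n l => -[_|n IH] l l0.
  apply: (@sub_finite_set _ _ [set fset0]); last exact: finite_set1.
  by move=> T [_ _ /eqP]; rewrite cardfs_eq0 => /eqP.
by have [] := @platform_towers_rec l n l0 => // m /andP[m0 _]; apply: IH => //; lia.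
Qed.

Lemma f_rec l n : (0 < l)%N ->
  f k l n.+1 = (\sum_(1 <= m < n.+2) stack_num k l m * f k m (n.+1 - m))%N.
Proof.
move=> l0; apply: (proj2 (platform_towers_rec l0 _)) => m /andP[m0 _].
exact: finite_platform_towers.
Qed.

Lemma f0 l : f k l 0 = 1%N.
Proof.
rewrite /f (_ : [set _ | _] = [set fset0]).
  by rewrite /num fset_set1 cardfs1.
apply/seteqP; split=> T /= => [[_ _ /eqP]|->]; first by rewrite cardfs_eq0 => /eqP.
split=> // r; exists 0, 0; apply/seteqP; split=> x /=; last by lia.
by case=> b.
Qed.

(** Each translation class has exactly one representative whose bottom row starts at column 0, and
    it has the form [base m T]. *)
Lemma g_sum n : g k n = (\sum_(1 <= m < n.+1) f k m (n - m))%N.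
Proof.
have [] := @num_bigcup _ _ _ (index_iota 1 n.+1) (fun m => platform_towers m (n - m))
  (fun m T => translates (base m T)) [set translates T | T in towers n].
- exact: iota_uniq.
- by move=> m; rewrite mem_index_iota => /andP[m0 _]; apply: finite_platform_towers.
- move=> m m' T T'; rewrite !mem_index_iota => /andP[m0 _] /andP[m0' _].
  move=> [[T0 _ _ _] _ _] [[T0' _ _ _] _ _] eqTT'.
  have : translates (base m T) (translate 0 (base m T)) by exists 0.
  rewrite eqTT' => -[c _ /esym] /(translate_base_inj m0 m0' T0 T0').
  by case.
- move=> v; split=> [[U tU <-]|[m [T [+ PT ->]]]].
    have [a [m [T [m0 PT ->]]]] := tower_decomp tU.
    exists m, T; split=> //; first by rewrite mem_index_iota ltnS.
    apply/seteqP; split=> _ [c _ <-].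
      by rewrite translateD; exists (c + a).
    by exists (c - a); rewrite // translateD subrK.
  rewrite mem_index_iota ltnS => /andP[m0 mn]; exists (base m T) => //.
  by have := base_tower m0 PT; rewrite subnKC.
by [].
Qed.

End Towers.

(** * Generating functions *)

Lemma big_nat_vanish (V : nmodType) (u : nat -> V) a p q :
  (a <= p)%N -> (p <= q)%N -> (forall m, (p <= m)%N -> u m = 0) ->
  \sum_(a <= m < q) u m = \sum_(a <= m < p) u m.
Proof.
move=> ap pq u0; rewrite (big_cat_nat ap pq) /= [X in _ + X]big1_seq ?addr0 // => m /andP[_].
by rewrite mem_index_iota => /andP[pm _]; apply: u0.
Qed.

Lemma F_platform_eq k l : (0 < k)%N -> (0 < l)%N -> platform_eq k (F k) l.
Proof.
move=> k0 l0; apply: fpsP => n; rewrite fps_coefD fps_coef_sum.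
pose u m : rat := if (m <= n)%N then (stack_num k l m * f k m (n - m))%N%:R else 0.
have uE m : fps_coef ((stack_num k l m)%:R * (z ^+ m * F k m)) n = u m.
  by rewrite fps_coef_natM fps_coefXnM /u natrM; case: leqP; rewrite ?mulr0.
rewrite (eq_bigr _ (fun m _ => uE m)).
have u0 m : (n < m)%N -> u m = 0 by rewrite /u ltnNge => /negbTE ->.
(* Both ranges extend to a common one: terms with m > n vanish because z^m exceeds the degree, and
   terms with m > l + 1 because [stack_num] is 0. *)
have -> : \sum_(1 <= m < l.+2) u m = \sum_(1 <= m < n.+1) u m.
  rewrite -(@big_nat_vanish _ u 1 n.+1 (l.+2 + n.+1)) ?leq_addl //.
  rewrite -(@big_nat_vanish _ u 1 l.+2 (l.+2 + n.+1)) ?leq_addr // => m lm.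
  by rewrite /u /stack_num (eqP lm) !mul0n if_same.
case: n => [|n] in u {uE u0} *; first by rewrite big_geq // addr0 /= f0.
rewrite /= f_rec // natr_sum add0r !big_nat; apply: eq_bigr => m /andP[_ mn].
by rewrite /u -ltnS mn.
Qed.

Lemma G_has_sum k : (0 < k)%N -> fps_has_sum (fun i => z ^+ i.+1 * F k i.+1) (G k).
Proof.
move=> k0 n; exists n => M nM.
pose u m : rat := if (m <= n)%N then (f k m (n - m))%:R else 0.
rewrite fps_coef_sum (eq_bigr (fun i : 'I_M => u i.+1)) => [|i _]; last by rewrite fps_coefXnM.
rewrite -(big_mkord xpredT (fun i => u i.+1)) -(big_add1 _ _ 0%N M.+1 xpredT u).
rewrite (@big_nat_vanish _ u 1 n.+1) // => [|m]; last by rewrite /u ltnNge => /negbTE ->.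
rewrite /= g_sum // natr_sum !big_nat; apply: eq_bigr => m /andP[_ mn].
by rewrite /u -ltnS mn.
Qed.

Theorem theorem2 (k : nat) (hk : (1 <= k)%N) :
  fps_has_sum (fun i : nat => z ^+ i.+1 * F k i.+1) (G k) /\
  forall l : nat, (1 <= l)%N ->
    F k l =
      ((1 + k%:R * z) * T k 1 l + (k%:R * z ^+ 2 - 1) * T k 2 l
         + (k%:R - 1) * z ^+ 3 * T k 3 l)
      / ((1 - (2 * k%:R - 1) * (1 + z) * z + k%:R ^+ 2 * z ^+ 3) * T k 1 2
         + (k%:R - 1) * ((2 * k%:R - 1) * z - 1) * z ^+ 3 * T k 1 3
         + (k%:R - 1) ^+ 2 * z ^+ 5 * T k 2 3).
Proof.
split; first exact: G_has_sum.
by apply: platform_eq_solution => // l l0; apply: F_platform_eq.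
Qed.
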